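(* Every clone $C$ on $\mathbb{Z}_8$ with $P(\mathbb{Z}_8,+)\subseteq C\subseteq M_1$ can be expressed as a join $$C(2t_{n_1})\vee C(2u_{n_2})\vee C(2v_{n_3})\vee C(2s_{n_4})\vee C(2p_{n_5})\vee C(2q_{n_6})\vee C(2r_{n_7})\vee C(4r_{n_8})$$ for suitable $n_1,\dots,n_8\in\{0,1,2,\dots\}\cup\{\infty\}$, where $n_i=0$ (and $n_3\in\{0,1\}$) means that the corresponding joinand is omitted (an empty join being $P(\mathbb{Z}_8,+)$), and $n_i=\infty$ means that the joinand is replaced by the join of the corresponding clones for all $n$ (e.g. $\bigvee_{n\ge1}C(2t_n)$).
   Context: All operations are on $\mathbb{Z}_8$; $\vee$ is the join in the lattice of clones on $\mathbb{Z}_8$. $P(\mathbb{Z}_8,+)$ is the clone of polynomial operations of the group $(\mathbb{Z}_8,+)$. For an operation $f$, $C(f)$ denotes the clone generated by $f$ together with binary addition and all unary constant operations. $P_4$ is the power set of $\{1,2,3,4\}$; for $A\in P_4$, $\mathbf{g}^A\in\mathbb{Z}_8^{P_4}$ has $B$-component $1$ if $A\subseteq B$ and $0$ otherwise; every $\mathbf{u}\in\mathbb{Z}_8^{P_4}$ has a unique expression $\mathbf{u}=\sum_{A\in P_4}a_A\mathbf{g}^A$, $a_A\in\mathbb{Z}_8$. $Z\subseteq\mathbb{Z}_8^{P_4}$ consists of all $\mathbf{u}$ with: (Z1) $a_{\{2\}}\equiv 2a_{\{1\}}\pmod 4$ and $a_{\{4\}}\equiv 2a_{\{3\}}\pmod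 4$; (Z2) $a_A\equiv0\pmod2$ whenever $|A|\ge2$; (Z3) $a_A\equiv 0\pmod 4$ whenever $|A|\ge2$ and $A\cap\{2,4\}\ne\emptyset$; (Z4) $a_A=0$ whenever $\{2,4\}\subseteq A$. $M_1$ is the clone of all polynomial operations of the ring $\mathbb{Z}_8$ that preserve $Z$ (componentwise). For $n\ge1$: $r_n=x_1\cdots x_n$; $t_n=x_1\cdots x_n(x_1+\dots+x_n)$ if $n$ is even and $t_n=x_1\cdots x_n(x_1+\dots+x_n+1)$ if $n$ is odd; $s_n=x_1\cdots x_n(x_1+\dots+x_n)$ if $n$ is odd and $s_n=x_1\cdots x_n(x_1+\dots+x_n+1)$ if $n$ is even; $p_n=x_1^2x_2\cdots x_n$; $q_n=x_1^3x_2\cdots x_n$; $u_n=x_1\cdots x_n(x_1+1)$; for $n\ge2$, $v_n=x_1\cdots x_n(x_1+x_2)$. *)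

(* Defs.v *)
From mathcomp Require Import all_boot all_order all_algebra.
Unset Printing Implicit Defensive.
Import GRing.Theory.
Local Open Scope ring_scope.

Definition Z8 : comUnitRingType := 'Z_8.

Definition op (n : nat) : Type := ('I_n -> Z8) -> Z8.

Definition opset : Type := forall n : nat, op n -> Prop.

Definition is_clone (C : opset) : Prop :=
  (forall n (i : 'I_n), C n (fun x => x i)) /\
  (forall m n (f : op m) (gs : 'I_m -> op n),
      C m f -> (forall i, C n (gs i)) -> C n (fun x => f (fun i => gs i x))).

Definition clone_gen (S : opset) : opset :=
  fun n f => forall D : opset, is_clone D -> (forall m g, S m g -> D m g) -> D n f.

Definition join2 (A B : opset) : opset := clone_gen (fun n g => A n g \/ B n g).
Definition join {I : Type} (F : I -> opset) : opset :=
  clone_gen (fun n g => exists i, F i n g).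

Definition osing {m : nat} (f : op m) : opset :=
  fun n g => exists e : m = n, eq_rect m op f n e = g.

Definition add_op : op 2 := fun x => x ord0 + x ord_max.
Definition mul_op : op 2 := fun x => x ord0 * x ord_max.
Definition const_op (c : Z8) : op 1 := fun _ => c.

Definition add_consts : opset :=
  fun n g => osing add_op n g \/ exists c, osing (const_op c) n g.

Definition PZ8 : opset := clone_gen add_consts.

Definition Pring : opset :=
  clone_gen (fun n g => add_consts n g \/ osing mul_op n g).

Definition Cf {m : nat} (f : op m) : opset :=
  clone_gen (fun n g => add_consts n g \/ osing f n g).

(** The subset Z of Z_8^{P_4}.  The set {1,2,3,4} is encoded as 'I_4,
    with k in {1,2,3,4} encoded as the ordinal k-1. *)
Definition gA (A B : {set 'I_4}) : Z8 := if A \subset B then 1 else 0.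

Definition cong4 (x y : Z8) : bool := ((x : nat) %% 4 == (y : nat) %% 4)%N.

Definition inZ (u : {set 'I_4} -> Z8) : Prop :=
  exists a : {set 'I_4} -> Z8,
    (forall B, u B = \sum_(A : {set 'I_4}) a A * gA A B) /\
    (cong4 (a [set inord 1]) (2 * a [set inord 0]) /\
     cong4 (a [set inord 3]) (2 * a [set inord 2])) /\
    (forall A : {set 'I_4}, (2 <= #|A|)%N -> ~~ odd (a A)) /\
    (forall A : {set 'I_4}, (2 <= #|A|)%N ->
       ((inord 1 : 'I_4) \in A) || ((inord 3 : 'I_4) \in A) -> (4 %| a A)%N) /\
    (forall A : {set 'I_4}, (inord 1 : 'I_4) \in A -> (inord 3 : 'I_4) \in A ->
       a A = 0).

Definition preservesZ {n : nat} (f : op n) : Prop :=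
  forall us : 'I_n -> ({set 'I_4} -> Z8),
    (forall i, inZ (us i)) -> inZ (fun B => f (fun i => us i B)).

Definition M1 : opset := fun n f => Pring n f /\ preservesZ f.

Definition prodx {n} (x : 'I_n -> Z8) : Z8 := \prod_(i < n) x i.
Definition sumx {n} (x : 'I_n -> Z8) : Z8 := \sum_(i < n) x i.

Definition r_op (n : nat) : op n := fun x => prodx x.
Definition t_op (n : nat) : op n := fun x => prodx x * (sumx x + (odd n)%:R).
Definition s_op (n : nat) : op n := fun x => prodx x * (sumx x + (~~ odd n)%:R).
Definition p_op (n : nat) : op n :=
  fun x => \prod_(i < n) x i ^+ (if val i == 0%N then 2 else 1)%N.
Definition q_op (n : nat) : op n :=
  fun x => \prod_(i < n) x i ^+ (if val i == 0%N then 3 else 1)%N.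
Definition u_op (n : nat) : op n :=
  fun x => prodx x * (\sum_(i < n | val i == 0%N) x i + 1).
Definition v_op (n : nat) : op n :=
  fun x => prodx x * \sum_(i < n | (val i < 2)%N) x i.

Definition scale_op (k : Z8) {n} (f : op n) : op n := fun x => k * f x.

Inductive ext_nat : Type := Fin of nat | Inf.

Definition ext_match (k : ext_nat) (n : nat) : Prop :=
  match k with Fin m => n = m | Inf => True end.

(** The joinand for parameter k: the join of C(fam n) over all admissible
    n >= lo matching k (k = Fin m: just C(fam m) if m >= lo, nothing
    otherwise; k = Inf: the join over all n >= lo). *)
Definition joinand (lo : nat) (fam : forall n, op n) (k : ext_nat) : opset :=
  join (fun n : {n : nat | (lo <= n)%N /\ ext_match k n} => Cf (fam (sval n))).

Definition join_expr (n1 n2 n3 n4 n5 n6 n7 n8 : ext_nat) : opset :=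
  join2 PZ8
  (join2 (joinand 1 (fun n => scale_op 2 (t_op n)) n1)
  (join2 (joinand 1 (fun n => scale_op 2 (u_op n)) n2)
  (join2 (joinand 2 (fun n => scale_op 2 (v_op n)) n3)
  (join2 (joinand 1 (fun n => scale_op 2 (s_op n)) n4)
  (join2 (joinand 1 (fun n => scale_op 2 (p_op n)) n5)
  (join2 (joinand 1 (fun n => scale_op 2 (q_op n)) n6)
  (join2 (joinand 1 (fun n => scale_op 2 (r_op n)) n7)
         (joinand 1 (fun n => scale_op 4 (r_op n)) n8)))))))).

(* Main.v *)
Require Import Defs.
From mathcomp Require Import all_boot all_order all_algebra.
From mathcomp Require Import fingroup perm ring.
From Stdlib Require Import Classical FunctionalExtensionality.
Set Implicit Arguments.
Unset Strict Implicit.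
Unset Printing Implicit Defensive.
Import GRing.Theory.
Local Open Scope ring_scope.

(** Write [R_n(a, b, c)] for the operation [redop a b c] of arity [n],
    [2 x_1 ... x_n (a + sum_i (x_i - 1) (c_i + b_i x_i))]; it depends on [a]
    modulo 4 and on [b], [c] modulo 2. Preservation of [Z] forces
    every [f] in [M1] that vanishes as soon as one argument is 0 to be some
    [R_n(a, b, c)], up to a multiple of [x_1] when [n = 1], and subtracting
    [f(x_i := 0)] for each [i] reduces every operation to that case.
    Substituting [x_i + x_0] for [x_i] in [R_n(a, b, c)] and keeping the part
    that involves both gives [R_(n+1)(2 c_i, 0, b_i (e_i + e_0))], and
    [x_i := 1] deletes the index [i]. Hence an odd [b_i] puts [2 v_(n+1)] in
    the clone, which for [n >= 2] generates all [R_n(a, b, c)] with [a] even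
    (for [n = 1] one uses [2 u_1] and [2 q_1]); and if [b = 0], an odd [c_i]
    puts [4 r_n] in the clone, so only the parity of [a] matters. Then [c]
    constant gives [t] or [s], a nonconstant [c] gives [v] and thus reduces
    [c] to 0 or [e_1], i.e. to [r], [u] or [p]. Finally each of the eight
    families is closed downwards in [n], so only the largest index in the clone
    (or its absence) matters. *)

(** * Arithmetic modulo 8 *)

Lemma Z8_ind (P : Z8 -> Prop) :
  P 0 -> P 1 -> P 2 -> P 3 -> P 4 -> P 5 -> P 6 -> P 7 -> forall x, P x.
Proof.
move=> p0 p1 p2 p3 p4 p5 p6 p7 x; have := natr_Zp x.
by case: x => [[|[|[|[|[|[|[|[|//]]]]]]]] i] /= <-.
Qed.

Lemma char8 : 8 = 0 :> Z8.
Proof. by apply/eqP. Qed.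

Lemma parity_spec (x : Z8) : if odd x then exists k, x = 1 + 2 * k else exists k, x = 2 * k.
Proof.
by elim/Z8_ind: x; [exists 0|exists 0|exists 1|exists 1
  |exists 2|exists 2|exists 3|exists 3]; apply/eqP.
Qed.

Lemma mul4_odd (x : Z8) : 4 * x = 4 * (odd x)%:R.
Proof. by elim/Z8_ind: x; apply/eqP. Qed.

Lemma even_mul_pred (x : Z8) : exists k, x * (x - 1) = 2 * k.
Proof.
by elim/Z8_ind: x; [exists 0|exists 0|exists 1|exists 3
  |exists 2|exists 2|exists 3|exists 1]; apply/eqP.
Qed.

Lemma op_ext n (f g : op n) : f =1 g -> f = g.
Proof. exact: functional_extensionality. Qed.

(** * Clones containing all affine operations *)

Definition affine_clone (D : opset) : Prop :=
  is_clone D /\ forall n f, PZ8 n f -> D n f.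

Section AffineClone.
Context (D : opset) (HD : affine_clone D).
Arguments D : clear implicits.

Lemma clone_proj n (i : 'I_n) : D n (fun x => x i).
Proof. by case: HD => -[]. Qed.

Lemma clone_comp m n (f : op m) (gs : 'I_m -> op n) :
  D m f -> (forall i, D n (gs i)) -> D n (fun x => f (fun i => gs i x)).
Proof. by case: HD => -[_ H] _; apply: H. Qed.

Lemma clone_reindex m n (f : op m) (s : 'I_m -> 'I_n) :
  D m f -> D n (fun x => f (fun i => x (s i))).
Proof. by move=> Df; apply: clone_comp => // i; apply: clone_proj. Qed.

(** The constants are given as unary operations, so a projection must be available to plug in; this
    forces positive arity. *)
Lemma clone_const n c : D n.+1 (fun _ => c).
Proof.
have Dc : D 1 (const_op c).
  by apply: (proj2 HD) => E _; apply; right; exists c; exists erefl.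
by apply: (clone_comp (gs := fun=> fun x => x ord0) Dc) => i; apply: clone_proj.
Qed.

Lemma clone_add n (f g : op n) : D n f -> D n g -> D n (fun x => f x + g x).
Proof.
move=> Df Dg; have Da : D 2 add_op by apply: (proj2 HD) => E _; apply; left; exists erefl.
pose gs (i : 'I_2) := if i == ord0 then f else g.
by apply: (clone_comp (gs := gs) Da) => i; rewrite /gs; case: ifP.
Qed.

Lemma clone_ext n (f g : op n) : D n f -> f =1 g -> D n g.
Proof. by move=> Df /op_ext <-. Qed.

Lemma clone_scale n (f : op n) k : D n f -> D n (fun x => k * f x).
Proof.
move=> Df; have Dm m : D n (fun x => m.+1%:R * f x).
  elim: m => [|m IH]; first by apply: (clone_ext Df) => x; rewrite mul1r.
  by apply: (clone_ext (clone_add Df IH)) => x; rewrite -{1}[f x]mul1r -mulrDl -mulrS.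
(* Repeated addition yields only positive multiples, so [k] is represented by [k + 8], which also
   covers [k = 0]. *)
apply: (clone_ext (Dm (k + 7)%N)) => x.
by rewrite -addnS natrD char8 addr0 natr_Zp.
Qed.

Lemma clone_sub n (f g : op n) : D n f -> D n g -> D n (fun x => f x - g x).
Proof.
move=> Df Dg; apply: (clone_ext (clone_add Df (clone_scale (-1) Dg))) => x.
by rewrite mulN1r.
Qed.

Lemma clone_sum (I : finType) n (F : I -> op n.+1) :
  (forall i, D n.+1 (F i)) -> D n.+1 (fun x => \sum_i F i x).
Proof.
move=> DF; elim: (index_enum I) => [|i r IH].
  by apply: (clone_ext (@clone_const n 0)) => x; rewrite big_nil.
by apply: (clone_ext (clone_add (DF i) IH)) => x; rewrite big_cons.
Qed.

End AffineClone.

(** * The operations [redop a b c] and their coefficients *)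

Definition redop {n} (a : Z8) (b c : 'I_n -> Z8) : op n :=
  fun x => 2 * (prodx x * (a + \sum_i (x i - 1) * (c i + b i * x i))).

Definition upd {n} (i : 'I_n) (y : Z8) (x : 'I_n -> Z8) : 'I_n -> Z8 :=
  fun j => if j == i then y else x j.

Lemma upd_eq n (i : 'I_n) y x : upd i y x i = y.
Proof. by rewrite /upd eqxx. Qed.

Lemma upd_neq n (i j : 'I_n) y x : j != i -> upd i y x j = x j.
Proof. by rewrite /upd => /negbTE ->. Qed.

Definition ind {n} (i j : 'I_n) : Z8 := (j == i)%:R.

Lemma sum_ind n (i : 'I_n) (F : 'I_n -> Z8) : \sum_j F j * ind i j = F i.
Proof.
rewrite (bigD1 i) //= /ind eqxx mulr1 big1 ?addr0 // => j /negbTE->.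
by rewrite mulr0.
Qed.

Lemma prodx_upd n (i : 'I_n) y x :
  prodx (upd i y x) = y * \prod_(j | j != i) x j.
Proof.
rewrite /prodx (bigD1 i) //= upd_eq; congr (_ * _).
by apply: eq_bigr => j ji; rewrite upd_neq.
Qed.

Lemma upd_same n (i : 'I_n) x : upd i (x i) x = x.
Proof. by apply: functional_extensionality => j; rewrite /upd; case: eqP => [->|]. Qed.

Lemma prodxD1 n (i : 'I_n) x : prodx x = x i * \prod_(j | j != i) x j.
Proof. exact: bigD1. Qed.

Lemma redop_upd n a b c (i : 'I_n) y x :
  redop a b c (upd i y x) =
  2 * (y * \prod_(j | j != i) x j *
    (a + ((y - 1) * (c i + b i * y) +
          \sum_(j | j != i) (x j - 1) * (c j + b j * x j)))).
Proof.
rewrite /redop prodx_upd [X in a + X](bigD1 i) //= upd_eq; congr (2 * (_ * (a + (_ + _)))).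
by apply: eq_bigr => j ji; rewrite upd_neq.
Qed.

Lemma redopD n a b c a' b' c' (x : 'I_n -> Z8) :
  redop (a + a') (fun i => b i + b' i) (fun i => c i + c' i) x =
  redop a b c x + redop a' b' c' x.
Proof.
rewrite /redop; have -> : \sum_i (x i - 1) * (c i + c' i + (b i + b' i) * x i) =
  \sum_i (x i - 1) * (c i + b i * x i) + \sum_i (x i - 1) * (c' i + b' i * x i).
  by rewrite -big_split; apply: eq_bigr => i _ /=; ring.
ring.
Qed.

Lemma redopZ n k a b c (x : 'I_n -> Z8) :
  redop (k * a) (fun i => k * b i) (fun i => k * c i) x = k * redop a b c x.
Proof.
rewrite /redop; have -> : \sum_i (x i - 1) * (k * c i + k * b i * x i) =
  k * \sum_i (x i - 1) * (c i + b i * x i).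
  by rewrite mulr_sumr; apply: eq_bigr => i _; ring.
ring.
Qed.

(** [redop a b c] depends only on [a] modulo 4 and on [b], [c] modulo 2, since
    [x (x - 1)] is always even. *)
Lemma redop_eqmod n a b c a' b' c' :
  2 * a = 2 * a' -> (forall i, 4 * b i = 4 * b' i) ->
  (forall i, 4 * c i = 4 * c' i) -> redop (n := n) a b c = redop a' b' c'.
Proof.
move=> ea eb ec; apply: op_ext => x; rewrite /redop !mulrDr; congr (_ + _).
  by rewrite mulrCA ea mulrCA.
rewrite !mulr_sumr; apply: eq_bigr => i _; rewrite (prodxD1 i).
have [k xk] := even_mul_pred (x i).
set P := \prod_(_ | _) _; transitivity (P * k * (4 * c i + 4 * b i * x i)).
  transitivity (P * (x i * (x i - 1)) * (2 * c i + 2 * b i * x i)); first by ring.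
  by rewrite xk; ring.
rewrite ec eb.
transitivity (P * (x i * (x i - 1)) * (2 * c' i + 2 * b' i * x i)); last by ring.
by rewrite xk; ring.
Qed.

Lemma sum_ind2 n (p q : 'I_n) k (x : 'I_n -> Z8) :
  \sum_j (x j - 1) * (k * (ind p j + ind q j) + 0 * x j) =
  k * ((x p - 1) + (x q - 1)).
Proof.
rewrite -(sum_ind p (fun j => x j - 1)) -(sum_ind q (fun j => x j - 1)).
by rewrite -big_split mulr_sumr; apply: eq_bigr => j _ /=; ring.
Qed.

(** * Substitutions and linear combinations of reduced operations *)

Section ReducedOperations.
Context (D : opset) (HD : affine_clone D).
Arguments D : clear implicits.

Lemma redop_add n a b c a' b' c' :
  D n (redop a b c) -> D n (redop a' b' c') ->
  D n (redop (a + a') (fun i => b i + b' i) (fun i => c i + c' i)).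
Proof.
by move=> D1 D2; apply: (clone_ext (clone_add HD D1 D2)) => x; rewrite redopD.
Qed.

Lemma redop_scale n k a b c : D n (redop a b c) ->
  D n (redop (k * a) (fun i => k * b i) (fun i => k * c i)).
Proof.
by move=> D1; apply: (clone_ext (clone_scale HD k D1)) => x; rewrite redopZ.
Qed.

Lemma redop_cong n a b c a' b' c' : D n (redop a b c) ->
  2 * a = 2 * a' -> (forall i, 4 * b i = 4 * b' i) ->
  (forall i, 4 * c i = 4 * c' i) -> D n (redop a' b' c').
Proof. by move=> D1 ea eb ec; rewrite -(redop_eqmod ea eb ec). Qed.

Lemma redop_sum (I : finType) n (a : I -> Z8) (b c : I -> 'I_n.+1 -> Z8) :
  (forall k, D n.+1 (redop (a k) (b k) (c k))) ->
  D n.+1 (redop (\sum_k a k) (fun i => \sum_k b k i) (fun i => \sum_k c k i)).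
Proof.
move=> DF; apply: (clone_ext (clone_sum HD DF)) => x; rewrite /redop.
rewrite -mulr_sumr -mulr_sumr big_split /=; congr (2 * (_ * (_ + _))).
rewrite exchange_big; apply: eq_bigr => i _ /=.
by rewrite -mulr_sumr big_split /= -mulr_suml.
Qed.

Lemma redop_perm n a b c (s : 'S_n) : D n (redop a b c) ->
  D n (redop a (fun i => b (s i)) (fun i => c (s i))).
Proof.
move=> D1; apply: (clone_ext (clone_reindex HD (fun i => (s^-1)%g i) D1)) => x.
rewrite /redop /prodx (reindex_inj (@perm_inj _ s)) /=.
rewrite [X in a + X](reindex_inj (@perm_inj _ s)) /=.
congr (2 * (_ * (a + _))); first by apply: eq_bigr => i _; rewrite permK.
by apply: eq_bigr => i _; rewrite permK.
Qed.

(** The factor [x i - 1] removes the summand of [i] once the constant 1 is substituted for [x i].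
    The arity stays positive, so this constant is available. *)
Lemma redop_restrict n a b c (i : 'I_n.+2) : D n.+2 (redop a b c) ->
  D n.+1 (redop a (fun j => b (lift i j)) (fun j => c (lift i j))).
Proof.
move=> D1; pose gs (j : 'I_n.+2) : op n.+1 :=
  if unlift i j is Some k then fun x => x k else fun=> 1.
have Dg j : D n.+1 (gs j).
  by rewrite /gs; case: unlift => *; [apply: clone_proj | apply: clone_const].
apply: (clone_ext (clone_comp HD D1 Dg)) => x.
rewrite /redop /prodx !(bigD1_ord i) //= /gs unlift_none mul1r subrr mul0r add0r.
by congr (2 * (_ * (a + _))); apply: eq_bigr => j _; rewrite liftK.
Qed.

(** Substitutes [x_i + x_0] for [x_i] and keeps the part that involves both. *)
Lemma redop_polarize n a b c (i : 'I_n) : D n (redop a b c) ->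
  D n.+1 (redop (2 * c i + 4 * b i) (fun=> 0)
            (fun j => 3 * b i * (ind ord0 j + ind (lift ord0 i) j))).
Proof.
move=> D1; pose F := redop a b c; pose y (x : 'I_n.+1 -> Z8) j := x (lift ord0 j).
have Dy : D n.+1 (fun x => F (y x)) by apply: clone_reindex.
have Dupd (g : op n.+1) : D n.+1 g -> D n.+1 (fun x => F (upd i (g x) (y x))).
  move=> Dg; apply: (clone_comp HD (gs := fun j x => upd i (g x) (y x) j)) => // j.
  by rewrite /upd; case: (j == i) => //; apply: clone_proj.
have pr k : D n.+1 (fun x => x k) by apply: clone_proj.
apply: (clone_ext (clone_sub HD (clone_sub HD
  (Dupd _ (clone_add HD (pr (lift ord0 i)) (pr ord0))) Dy) (Dupd _ (pr ord0)))) => x.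
have -> : F (y x) = F (upd i (y x i) (y x)) by rewrite upd_same.
rewrite /F !redop_upd /redop sum_ind2 /prodx big_ord_recl.
rewrite (_ : \prod_(j < n) x (lift ord0 j) = prodx (y x)) // (prodxD1 i) /y.
set P := \prod_(_ | _) _; set S := \sum_(_ | _) _; ring.
Qed.

(** For even [b i], polarizing at [i] leaves only [2 * c i] in the place of [a], and this is 2
    modulo 4. Deleting the new variable restores the arity. *)
Lemma redop_double n a b c (i : 'I_n.+1) : D n.+1 (redop a b c) ->
  odd (c i) -> ~~ odd (b i) -> D n.+1 (redop 2 (fun=> 0) (fun=> 0)).
Proof.
move=> /(redop_polarize i) /(redop_restrict ord0) D1 ci bi.
have b4 : 4 * b i = 0 by rewrite mul4_odd (negbTE bi) mulr0.
have c4 : 4 * c i = 4 by rewrite mul4_odd ci mulr1.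
apply: (redop_cong D1) => // [|j].
  transitivity (4 * c i + 2 * (4 * b i)); first by ring.
  by rewrite b4 c4; ring.
transitivity (4 * b i * (3 * (ind ord0 (lift ord0 j) + ind (lift ord0 i) (lift ord0 j)))).
  ring.
by rewrite b4; ring.
Qed.

Lemma redop_parity n (a a' : Z8) b c :
  D n (redop 2 (fun=> 0) (fun=> 0)) -> odd a = odd a' ->
  D n (redop a b c) -> D n (redop a' b c).
Proof.
move=> D2 aa' D1; have [k ek] : exists k, a' = a + k * 2.
  move: (parity_spec a) (parity_spec a'); rewrite -aa'.
  by case: ifP => _ [k ->] [k' ->]; exists (k' - k); ring.
by apply: (redop_cong (redop_add D1 (redop_scale k D2))) => [|i|i] /=; rewrite ?ek; ring.
Qed.

End ReducedOperations.

(** * The eight families as reduced operations *)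

Inductive family := FT | FU | FV | FS | FP | FQ | FR | FR4.

Definition fam_lo (F : family) : nat := if F is FV then 2 else 1.

Definition fam_op (F : family) (n : nat) : op n :=
  match F with
  | FT => scale_op 2 (t_op n)
  | FU => scale_op 2 (u_op n)
  | FV => scale_op 2 (v_op n)
  | FS => scale_op 2 (s_op n)
  | FP => scale_op 2 (p_op n)
  | FQ => scale_op 2 (q_op n)
  | FR => scale_op 2 (r_op n)
  | FR4 => scale_op 4 (r_op n)
  end.
Arguments fam_op : clear implicits.

Lemma odd_natr m : odd (m%:R : Z8) = odd m.
Proof. by rewrite (@val_Zp_nat 8) // odd_mod. Qed.

Definition ord_one {n} : 'I_n.+2 := lift ord0 ord0.

Lemma sum_const_coef n k (x : 'I_n -> Z8) :
  \sum_j (x j - 1) * (k + 0 * x j) = k * (sumx x - n%:R).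
Proof.
rewrite (eq_bigr (fun j => k * (x j - 1))) => [|j _]; last by ring.
by rewrite -mulr_sumr sumrB sumr_const card_ord.
Qed.

Lemma sum_ind_coef n (p : 'I_n) k (x : 'I_n -> Z8) :
  \sum_j (x j - 1) * (ind p j + k * ind p j * x j) = (x p - 1) * (1 + k * x p).
Proof.
rewrite -(sum_ind p (fun j => (x j - 1) * (1 + k * x j))).
by apply: eq_bigr => j _; ring.
Qed.

Lemma fam_RE n : fam_op FR n = redop 1 (fun=> 0) (fun=> 0).
Proof.
by apply: op_ext => x; rewrite /= /scale_op /r_op /redop sum_const_coef; ring.
Qed.

Lemma fam_R4E n : fam_op FR4 n = redop 2 (fun=> 0) (fun=> 0).
Proof.
by apply: op_ext => x; rewrite /= /scale_op /r_op /redop sum_const_coef; ring.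
Qed.

(** The sum of the [x i - 1] differs from [sumx x] by [n]. The case distinction in [t_op] makes
    [n + odd n] always even; the one in [s_op] makes the corresponding number always odd. *)
Lemma fam_TE n : fam_op FT n = redop (n + odd n)%:R (fun=> 0) (fun=> 1).
Proof.
by apply: op_ext => x; rewrite /= /scale_op /t_op /redop sum_const_coef natrD; ring.
Qed.

Lemma fam_SE n : fam_op FS n = redop (n + ~~ odd n)%:R (fun=> 0) (fun=> 1).
Proof.
by apply: op_ext => x; rewrite /= /scale_op /s_op /redop sum_const_coef natrD; ring.
Qed.

Lemma sum_first n (x : 'I_n.+1 -> Z8) : \sum_(i < n.+1 | val i == 0%N) x i = x ord0.
Proof. by rewrite (big_pred1 ord0). Qed.

Lemma prod_first n e (x : 'I_n.+1 -> Z8) :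
  \prod_(i < n.+1) x i ^+ (if val i == 0%N then e.+1 else 1%N) = x ord0 ^+ e * prodx x.
Proof. by rewrite /prodx !big_ord_recl /= exprSr mulrA. Qed.

Lemma fam_UE n : fam_op FU n.+1 = redop 2 (fun=> 0) (ind ord0).
Proof.
apply: op_ext => x; rewrite /= /scale_op /u_op sum_first /redop.
have := sum_ind_coef ord0 0 x; under eq_bigr do rewrite mul0r; move=> ->.
ring.
Qed.

Lemma fam_PE n : fam_op FP n.+1 = redop 1 (fun=> 0) (ind ord0).
Proof.
apply: op_ext => x; rewrite /= /scale_op /p_op prod_first /redop.
have := sum_ind_coef ord0 0 x; under eq_bigr do rewrite mul0r; move=> ->.
ring.
Qed.

Lemma fam_QE n : fam_op FQ n.+1 = redop 1 (ind ord0) (ind ord0).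
Proof.
apply: op_ext => x; rewrite /= /scale_op /q_op prod_first /redop.
have := sum_ind_coef ord0 1 x; under eq_bigr do rewrite mul1r; move=> ->.
ring.
Qed.

Lemma fam_VE n :
  fam_op FV n.+2 = redop 2 (fun=> 0) (fun j => 1 * (ind ord0 j + ind ord_one j)).
Proof.
apply: op_ext => x; rewrite /= /scale_op /v_op /redop sum_ind2.
rewrite big_mkcond !big_ord_recl /= big1 // -/ord_one.
ring.
Qed.

Lemma ind_lift n (i : 'I_n.+1) (p j : 'I_n) : ind (lift i p) (lift i j) = ind p j.
Proof. by rewrite /ind (inj_eq lift_inj). Qed.

(** A variable is set to 1, the last one where the first one or two play a special role. For [t] and
    [s] the value of [a] then belongs to the wrong arity, but its parity is right, and [4 r_n]
    corrects the rest. *)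
Lemma fam_down D F n : affine_clone D -> (fam_lo F <= n)%N ->
  D n.+1 (fam_op F n.+1) -> D n (fam_op F n).
Proof.
move=> HD; case: n => [|n]; first by case: F.
have l0 : ord0 = lift ord_max ord0 :> 'I_n.+2 by apply: val_inj.
have i0 (j : 'I_n.+1) : ind ord0 (lift ord_max j) = ind ord0 j.
  by rewrite {1}l0 ind_lift.
have const_case m : D n.+2 (redop m (fun=> 0) (fun=> 1)) ->
    D n.+1 (redop m (fun=> 0) (fun=> 1)) /\ D n.+1 (redop 2 (fun=> 0) (fun=> 0)).
  move=> /(redop_restrict HD ord0) D1; split=> //.
  exact: (redop_double HD (i := ord0) D1).
case: F => lo.
- rewrite !fam_TE => /const_case[D1 D2]; apply: (redop_parity HD D2 _ D1).
  by rewrite !odd_natr /= !oddD; case: (odd n).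
- rewrite !fam_UE => /(redop_restrict HD ord_max) D1.
  by apply: (redop_cong D1) => // j; rewrite i0.
- case: n lo l0 i0 const_case => // n _ l0 i0 _.
  rewrite !fam_VE => /(redop_restrict HD ord_max) D1.
  apply: (redop_cong D1) => // j; rewrite i0.
  by rewrite (_ : ord_one = lift ord_max ord_one) ?ind_lift //; apply: val_inj.
- rewrite !fam_SE => /const_case[D1 D2]; apply: (redop_parity HD D2 _ D1).
  by rewrite !odd_natr /= !oddD; case: (odd n).
- rewrite !fam_PE => /(redop_restrict HD ord_max) D1.
  by apply: (redop_cong D1) => // j; rewrite i0.
- rewrite !fam_QE => /(redop_restrict HD ord_max) D1.
  by apply: (redop_cong D1) => // j; rewrite i0.
- by rewrite !fam_RE => /(redop_restrict HD ord_max).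
- by rewrite !fam_R4E => /(redop_restrict HD ord_max).
Qed.

Lemma odd_mul2 (x : Z8) : odd (2 * x)%R = false.
Proof. by elim/Z8_ind: x. Qed.

Lemma odd_mul4 (x : Z8) : odd x -> 4 * x = 4.
Proof. by move=> ox; rewrite mul4_odd ox mulr1. Qed.

Lemma even_mul4 (x : Z8) : ~~ odd x -> 4 * x = 0.
Proof. by move=> /negbTE ox; rewrite mul4_odd ox mulr0. Qed.

Lemma ind_perm n (s : 'S_n) p j : ind p (s j) = ind ((s^-1)%g p) j.
Proof. by rewrite /ind -(inj_eq (@perm_inj _ s^-1)%g) permK. Qed.

(** * What [2 v_n] and the unary family members generate *)

Section Generation.
Context (D : opset) (HD : affine_clone D).
Arguments D : clear implicits.

Lemma redop_zero n : D n.+1 (redop 0 (fun=> 0) (fun=> 0)).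
Proof.
apply: (clone_ext (clone_const HD n 0)) => x.
by rewrite /redop sum_const_coef !(mul0r, addr0, mulr0).
Qed.

(** Polarizing at [i] gives odd coefficients exactly at [ord0] and [lift ord0 i]; a transposition
    moves this pair to the first two places. The resulting [a] is even, and [redop_double] allows
    replacing it by 2. *)
Lemma fam_V_of_odd n a b c (i : 'I_n.+1) :
  D n.+1 (redop a b c) -> odd (b i) -> D n.+2 (fam_op FV n.+2).
Proof.
move=> /(redop_polarize HD i) D1 /odd_mul4 bi; rewrite fam_VE.
have {}D1 : D n.+2 (redop (2 * c i + 4 * b i) (fun=> 0)
    (fun j => 1 * (ind ord0 j + ind (lift ord0 i) j))).
  apply: (redop_cong D1) => // j; set X := _ + _.
  transitivity (3 * (4 * b i) * X); first by ring.
  by rewrite bi; transitivity (4 * (1 * X) + 8 * X); [ring | rewrite char8; ring].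
have {}D1 := redop_perm HD (tperm ord_one (lift ord0 i)) D1.
have {}D1 : D n.+2 (redop (2 * c i + 4 * b i) (fun=> 0)
    (fun j => 1 * (ind ord0 j + ind ord_one j))).
  by apply: (redop_cong D1) => // j; rewrite !ind_perm tpermV tpermR tpermD.
apply: (redop_parity HD _ _ D1).
  by apply: (redop_double HD (i := ord0) D1).
have -> : 2 * c i + 4 * b i = 2 * (c i + 2 * b i) by ring.
by rewrite odd_mul2.
Qed.

(** Setting one variable of the pair to 1 gives [2 u], and doubling gives [4 r]; their difference is
    a single [c] coefficient. Identifying two variables instead gives a single [b] coefficient.
    These span everything with even [a]. *)
Lemma redop_mem_of_V n k b c :
  D n.+3 (fam_op FV n.+3) -> D n.+2 (redop (2 * k) b c).
Proof.
rewrite fam_VE => DV.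
have DU : D n.+2 (redop 2 (fun=> 0) (ind ord0)).
  apply: (redop_cong (redop_restrict HD ord_one DV)) => // j.
  have l0 : ord0 = lift ord_one ord0 :> 'I_n.+3 by apply: val_inj.
  have -> : ind ord_one (lift ord_one j) = 0 by rewrite /ind eq_sym (negbTE (neq_lift _ _)).
  by rewrite {1}l0 ind_lift; ring.
have D2 := redop_double HD (i := ord0) DU isT isT.
have Dc i : D n.+2 (redop 0 (fun=> 0) (ind i)).
  have D0 := redop_add HD DU (redop_scale HD (-1) D2).
  apply: (redop_cong (redop_perm HD (tperm ord0 i) D0)) => [|j|j] /=; try ring.
  by rewrite !ind_perm tpermV tpermL; ring.
have Db i : D n.+2 (redop 0 (ind i) (fun=> 0)).
  suff D0 : D n.+2 (redop 0 (ind ord_one) (fun=> 0)).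
    apply: (redop_cong (redop_perm HD (tperm ord_one i) D0)) => // j.
    by rewrite !ind_perm tpermV tpermL.
  (* Identify the variables 0 and 2 of [v_(n+3)]; the variables 1 and 2 become
     0 and 1. *)
  pose s (j : 'I_n.+3) := odflt ord_one (unlift ord0 j).
  apply: (clone_ext (clone_sub HD (clone_reindex HD s DV) DU)) => x.
  rewrite /redop sum_ind2; have := sum_ind_coef ord0 0 x.
  under eq_bigr do rewrite mul0r; move=> ->.
  have -> : \sum_j (x j - 1) * (0 + ind ord_one j * x j) = (x ord_one - 1) * x ord_one.
    by rewrite -(sum_ind ord_one (fun j => (x j - 1) * x j)); apply: eq_bigr => j _; ring.
  rewrite /prodx !big_ord_recl /s /ord_one !liftK !unlift_none /= -/ord_one.
  pose P := \prod_(j < n) x (lift ord0 (lift ord0 j)); rewrite -/P.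
  rewrite [X in x ord_one * (x ord0 * (x ord_one * X))](_ : _ = P); last first.
    by apply: eq_bigr => j _; rewrite liftK.
  (* The two sides differ by twice a multiple of two products of consecutive elements, hence by a
     multiple of 8. *)
  have [k1 e1] := even_mul_pred (x ord0 + 1); have [k2 e2] := even_mul_pred (x ord_one).
  have z : 2 * P * ((x ord0 + 1) * (x ord0 + 1 - 1)) * (x ord_one * (x ord_one - 1)) = 0.
    by rewrite e1 e2; transitivity (8 * (P * k1 * k2)); [ring | rewrite char8 mul0r].
  apply/eqP; rewrite -subr_eq0; apply/eqP; refine (etrans _ z); ring.
have S1 := redop_sum HD (fun i => redop_scale HD (b i) (Db i)).
have S2 := redop_sum HD (fun i => redop_scale HD (c i) (Dc i)).
apply: (redop_cong (redop_add HD (redop_add HD S1 S2) (redop_scale HD k D2))) => [|i|i] /=.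
- by rewrite !big1 => [|i _|i _]; ring.
- rewrite [X in _ + X + _]big1 => [|j _]; last by ring.
  rewrite (eq_bigr (fun j => b j * ind i j)) => [|j _]; last by rewrite /ind eq_sym.
  by rewrite sum_ind; ring.
- rewrite big1 => [|j _]; last by ring.
  rewrite (eq_bigr (fun j => c j * ind i j)) => [|j _]; last by rewrite /ind eq_sym.
  by rewrite sum_ind; ring.
Qed.

Lemma fam_R1 : D 1 (fam_op FR 1).
Proof.
apply: (clone_ext (clone_scale HD 2 (clone_proj HD ord0))) => x.
by rewrite /= /scale_op /r_op /prodx big_ord1.
Qed.

Lemma redop_mem_of_UQ a b c :
  D 1 (fam_op FU 1) -> D 1 (fam_op FQ 1) -> D 1 (redop a b c).
Proof.
have := fam_R1; rewrite fam_RE fam_UE fam_QE => DR DU DQ.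
(* The triples of [r], [u], [q] in arity 1 are (1,0,0), (2,0,1), (1,1,1) in the order [a], [b], [c];
   the triangular system is solved for [(a, b, c)]. *)
pose k2 := c ord0 - b ord0; pose k3 := b ord0; pose k1 := a - 2 * k2 - k3.
apply: (redop_cong (redop_add HD (redop_add HD (redop_scale HD k1 DR)
  (redop_scale HD k2 DU)) (redop_scale HD k3 DQ))) => [|i|i] /=;
  rewrite ?(ord1 i) /ind ?eqxx /k1 /k2 /k3 /=; ring.
Qed.

(** Modulo the pairs [x_0 + x_j], every coefficient family is concentrated on
    [x_0]. *)
Lemma redop_concentrate n a c :
  D n.+2 (redop 2 (fun=> 0) (fun=> 0)) -> D n.+2 (fam_op FV n.+2) ->
  D n.+2 (redop a (fun=> 0) c) <->
  D n.+2 (redop a (fun=> 0) (fun j => - (\sum_i c i) * ind ord0 j)).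
Proof.
move=> D2; rewrite fam_VE => DV.
have D0 := redop_add HD DV (redop_scale HD (-1) D2).
have Dp j : D n.+2 (redop 0 (fun=> 0) (fun i => ind ord0 i + ind j i)).
  (* For [j = ord0] the pair degenerates to [2 * ind ord0], which is zero modulo 2. *)
  have [->|j0] := eqVneq j ord0.
    apply: (redop_cong (redop_zero n.+1)) => // i.
    by transitivity (8 * ind ord0 i); [rewrite char8; ring | ring].
  apply: (redop_cong (redop_perm HD (tperm ord_one j) D0)) => [|i|i] /=; try ring.
  by rewrite !ind_perm tpermV tpermL tpermD ?(eq_sym j) //; [ring | rewrite eq_sym].
have S := redop_sum HD (fun j => redop_scale HD (c j) (Dp j)).
have eS i : \sum_j c j * (ind ord0 i + ind j i) = (\sum_j c j) * ind ord0 i + c i.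
  rewrite -[c i in RHS](sum_ind i c) mulr_suml -big_split; apply: eq_bigr => j _ /=.
  by rewrite /ind (eq_sym i j); ring.
have e0 m : \sum_(j < n.+2) c j * m * 0 = 0 by rewrite big1 // => j _; ring.
split=> D1.
  apply: (redop_cong (redop_add HD D1 (redop_scale HD (-1) S))) => [|i|i] /=.
  - by rewrite big1 => [|j _]; ring.
  - by rewrite big1 => [|j _]; ring.
  - by rewrite eS; ring.
apply: (redop_cong (redop_add HD D1 S)) => [|i|i] /=.
- by rewrite big1 => [|j _]; ring.
- by rewrite big1 => [|j _]; ring.
- by rewrite eS; ring.
Qed.

End Generation.

(** * Reduced operations pass from [C] to any [J] receiving the family members of [C] *)

Section Transfer.
Context (C J : opset) (HC : affine_clone C) (HJ : affine_clone J).
Arguments C : clear implicits.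
Arguments J : clear implicits.
Hypothesis CJ : forall F n, (fam_lo F <= n)%N -> C n (fam_op F n) -> J n (fam_op F n).

Lemma redop_mem_const n a : C n.+1 (redop a (fun=> 0) (fun=> 0)) ->
  J n.+1 (redop a (fun=> 0) (fun=> 0)).
Proof.
move=> Ca; case oa: (odd a).
  (* Each odd residue modulo 8 is its own inverse, so scaling by [a] leads from the given operation
     to [2 r] and back. *)
  have aa : a * a = 1 by move: oa; elim/Z8_ind: (a) => // _; apply/eqP.
  have : C n.+1 (fam_op FR n.+1).
    by rewrite fam_RE; apply: (redop_cong (redop_scale HC a Ca)) => *; rewrite /= ?aa; ring.
  move=> /(CJ (F := FR) (n := n.+1) isT); rewrite fam_RE => J1.
  by apply: (redop_cong (redop_scale HJ a J1)) => * /=; ring.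
have [k ak] : exists k, a = 2 * k by have := parity_spec a; rewrite oa.
case ok: (odd k).
  have e4 : 2 * a = 2 * 2.
    by rewrite ak; transitivity (4 * k); [ring | rewrite (odd_mul4 ok); ring].
  have : C n.+1 (fam_op FR4 n.+1) by rewrite fam_R4E; apply: (redop_cong Ca).
  move=> /(CJ (F := FR4) (n := n.+1) isT); rewrite fam_R4E => J1.
  by apply: (redop_cong J1).
apply: (redop_cong (redop_zero HJ n)) => //; rewrite ak.
by transitivity (4 * k); [rewrite even_mul4 ?ok //|]; ring.
Qed.

(** Both clones contain [2 v] one arity higher. In arity at least 2 this supplies everything with
    even [a], so [a] is split into an even part and a remainder 0 or 1 that is transferred by
    [redop_mem_const]. Arity 1 is handled through [2 u_1] and [2 q_1]. *)
Lemma redop_mem_odd_b n a b c (i : 'I_n.+1) :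
  C n.+1 (redop a b c) -> odd (b i) -> J n.+1 (redop a b c).
Proof.
move=> Ca bi; have CV := fam_V_of_odd HC Ca bi.
have JV := CJ (F := FV) (n := n.+2) isT CV.
case: n => [|n] in a b c i Ca bi CV JV *.
  have CR := fam_R1 HC; rewrite fam_RE in CR.
  have CU : C 1 (fam_op FU 1).
    move: CV; rewrite fam_VE => /(redop_restrict HC ord_one) CV.
    rewrite fam_UE; apply: (redop_cong CV) => // j.
    by rewrite (ord1 j) /ind /=; ring.
  suff CQ : C 1 (fam_op FQ 1) by apply: (redop_mem_of_UQ HJ); apply: CJ.
  rewrite fam_UE in CU; rewrite fam_QE.
  (* Adding [k2] copies of [2 u_1] turns [c] into 1, and [k1] copies of [2 r_1] then turn [a] into
     1; [b] is already 1 modulo 2. *)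
  pose k2 := 1 - c ord0; pose k1 := 1 - a - 2 * k2.
  have := redop_add HC (redop_add HC Ca (redop_scale HC k1 CR)) (redop_scale HC k2 CU).
  rewrite (ord1 i) in bi; move: (odd_mul4 bi) => b4.
  move=> /redop_cong; apply=> [|j|j] /=; rewrite ?(ord1 j) /ind ?eqxx /k1 /k2 /=; try ring.
  by transitivity (4 * b ord0); [ring | rewrite b4; ring].
have [k [r [ak Jr]]] : exists k r, a = 2 * k + r /\ J n.+2 (redop r (fun=> 0) (fun=> 0)).
  have [k [r [ak jr]]] : exists k r : Z8, a = 2 * k + r /\ (r = 0 \/ r = 1).
    have := parity_spec a; case: ifP => _ [k ->]; exists k; [exists 1 | exists 0].
      by split; [ring | right].
    by split; [ring | left].
  exists k, r; split=> //; apply: redop_mem_const.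
  have := redop_add HC Ca (redop_scale HC (-1) (redop_mem_of_V HC k b c CV)).
  by move=> /redop_cong; apply=> * /=; rewrite ?ak; ring.
have := redop_add HJ (redop_mem_of_V HJ k b c JV) Jr.
by move=> /redop_cong; apply=> * /=; rewrite ?ak; ring.
Qed.

Lemma redop_mem_odd_c n a c (i : 'I_n.+1) :
  C n.+1 (redop a (fun=> 0) c) -> odd (c i) -> J n.+1 (redop a (fun=> 0) c).
Proof.
move=> Ca ci; have C2 := redop_double HC Ca ci isT.
have J2 : J n.+1 (redop 2 (fun=> 0) (fun=> 0)).
  by move: C2; rewrite -fam_R4E; apply: CJ.
(* Both clones contain [4 r], so a family member need only agree with the operation in the parity of
   [a] and of the [c] coefficients. *)
have transfer F a' c' : fam_op F n.+1 = redop a' (fun=> 0) c' ->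
    (fam_lo F <= n.+1)%N -> odd a = odd a' -> forall c'', C n.+1 (redop a (fun=> 0) c'') ->
    (forall j, 4 * c'' j = 4 * c' j) -> J n.+1 (redop a (fun=> 0) c'').
  move=> eF lF ea c'' Ca'' ec.
  have : C n.+1 (fam_op F n.+1).
    by rewrite eF; apply: (redop_parity HC C2 ea); apply: (redop_cong Ca'').
  move=> /(CJ lF); rewrite eF => /(redop_parity HJ J2 (esym ea)) Ja.
  by apply: (redop_cong Ja).
have [call|] := boolP [forall j, odd (c j)].
  have c4 j : 4 * c j = 4 * 1 by rewrite (odd_mul4 (forallP call j)); ring.
  case oa: (odd a).
    apply: (transfer FS _ _ (fam_SE _)) => //.
    by rewrite odd_natr oddD oa; case: (odd n.+1).
  apply: (transfer FT _ _ (fam_TE _)) => //.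
  by rewrite odd_natr oddD oa; case: (odd n.+1).
rewrite negb_forall => /existsP[j cj].
case: n => [|n] in a c i Ca ci C2 J2 transfer j cj *.
  by move: ci; rewrite (ord1 i) -(ord1 j) (negbTE cj).
have CV : C n.+2 (fam_op FV n.+2).
  have ij : i != j by apply: contraNneq cj => <-.
  (* Swapping [i] and [j] and subtracting cancels [a] and all coefficients except those at [i] and
     [j], which become odd because [c i] and [c j] have different parities. *)
  have D0 : C n.+2 (redop 0 (fun=> 0) (fun k => 1 * (ind i k + ind j k))).
    have := redop_add HC Ca (redop_scale HC (-1) (redop_perm HC (tperm i j) Ca)).
    move=> /redop_cong; apply=> [|k|k] /=; try ring.
    have ci4 := odd_mul4 ci; have cj4 := even_mul4 cj.
    rewrite /ind; case: tpermP => [->|->|/eqP/negbTE-> /eqP/negbTE->]; last by rewrite /=; ring.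
      rewrite eqxx (negbTE ij) /=; transitivity (4 * c i - 4 * c j); first by ring.
      by rewrite ci4 cj4; ring.
    rewrite eqxx (eq_sym j) (negbTE ij) /=; transitivity (4 * c j - 4 * c i); first by ring.
    by rewrite ci4 cj4; apply/eqP.
  rewrite fam_VE; have {}D0 := redop_add HC D0 C2.
  have [s [s0 s1]] : exists s : 'S_n.+2, s i = ord0 /\ s j = ord_one.
    (* The first transposition sends [i] to [ord0] and [j] to [z]; since [z] is not [ord0], the
       second one leaves [ord0] fixed. *)
    pose z := tperm i ord0 j; exists (tperm i ord0 * tperm z ord_one)%g.
    have z0 : z != ord0.
      apply: contraNneq ij => e.
      by rewrite -(inj_eq (@perm_inj _ (tperm i ord0))) tpermL -/z e.
    by rewrite !permM tpermL -/z tpermL tpermD.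
  have := redop_perm HC (s^-1)%g D0.
  move=> /redop_cong; apply=> [|k|k] /=; try ring.
  by rewrite !ind_perm invgK s0 s1; ring.
have JV : J n.+2 (fam_op FV n.+2) by apply: CJ.
apply/(redop_concentrate HJ a c J2 JV); move/(redop_concentrate HC a c C2 CV): Ca.
case ok: (odd (- \sum_k c k)) => Ca.
  have e4 (k : 'I_n.+2) : 4 * (- (\sum_k c k) * ind ord0 k) = 4 * ind ord0 k.
    by rewrite mulrA (odd_mul4 ok).
  case oa: (odd a).
    by apply: (transfer FP _ _ (fam_PE _)).
  by apply: (transfer FU _ _ (fam_UE _)).
have e4 (k : 'I_n.+2) : 4 * (- (\sum_k c k) * ind ord0 k) = 4 * 0.
  by rewrite mulrA even_mul4 ?ok //; ring.
have J0 := redop_mem_const (redop_cong Ca erefl (fun=> erefl) e4).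
by apply: (redop_cong J0) => // k; rewrite e4.
Qed.

Lemma redop_mem n a b c : C n.+1 (redop a b c) -> J n.+1 (redop a b c).
Proof.
move=> Ca; have [/existsP[i bi]|] := boolP [exists i, odd (b i)].
  exact: redop_mem_odd_b Ca bi.
rewrite negb_exists => /forallP b0.
have b4 i : 4 * b i = 4 * 0 by rewrite even_mul4 //; ring.
suff J0 : J n.+1 (redop a (fun=> 0) c) by apply: (redop_cong J0).
have {}Ca : C n.+1 (redop a (fun=> 0) c) by apply: (redop_cong Ca).
have [/existsP[i ci]|] := boolP [exists i, odd (c i)].
  exact: redop_mem_odd_c Ca ci.
rewrite negb_exists => /forallP c0.
have c4 i : 4 * c i = 4 * 0 by rewrite even_mul4 //; ring.
have J0 := redop_mem_const (redop_cong Ca erefl (fun=> erefl) c4).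
by apply: (redop_cong J0).
Qed.

End Transfer.

(** * Coefficients of vectors in [Z] and the laws they impose on operations *)

Lemma subset_sum0 (a : {set 'I_4} -> Z8) : \sum_B a B * gA B set0 = a set0.
Proof.
rewrite (bigD1 set0) //= /gA subxx mulr1 big1 ?addr0 // => B.
by rewrite subset0 => /negbTE ->; rewrite mulr0.
Qed.

Lemma subset_sum1 (a : {set 'I_4} -> Z8) (i : 'I_4) :
  \sum_B a B * gA B [set i] = a set0 + a [set i].
Proof.
have i0 : [set i] != set0 by apply/set0Pn; exists i; rewrite inE.
rewrite (bigD1 set0) //= (bigD1 [set i]) //= /gA sub0set subxx !mulr1.
rewrite big1 ?addr0 // => B; rewrite subset1 => /andP[/negbTE -> /negbTE ->].
by rewrite mulr0.
Qed.

Lemma subset_sum_pair (a : {set 'I_4} -> Z8) (i j : 'I_4) : i != j ->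
  \sum_B a B * gA B [set i; j] = a set0 + a [set i] + a [set j] + a [set i; j].
Proof.
move=> ij; have ji : j != i by rewrite eq_sym.
have ne (B B' : {set 'I_4}) k : k \in B -> k \notin B' -> B != B'.
  by move=> kB; apply: contraNneq => <-.
have e0 k (B : {set 'I_4}) : k \in B -> B != set0 by move=> kB; rewrite (ne _ _ k) ?inE.
have e1 : [set j] != [set i] by rewrite (ne _ _ j) ?inE.
have e2 : [set i; j] != [set i] by rewrite (ne _ _ j) ?inE ?eqxx ?orbT.
have e3 : [set i; j] != [set j] by rewrite (ne _ _ i) ?inE ?eqxx.
rewrite (bigD1 set0) //= (bigD1 [set i]) ?(e0 i) ?inE //=.
rewrite (bigD1 [set j]) /= ?e1 ?(e0 j) ?inE //.
rewrite (bigD1 [set i; j]) /= ?e2 ?e3 ?(e0 i) ?inE ?eqxx //.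
rewrite /gA sub0set subsetUl subsetUr subxx !mulr1 big1 ?addr0 ?addrA // => B.
move=> /andP[/andP[/andP[B0 Bi] Bj] Bij]; case: ifP => [BS|]; last by rewrite mulr0.
exfalso; move: B0 Bi Bj Bij; case Bi: (i \in B); case Bj: (j \in B).
- suff -> : B = [set i; j] by rewrite eqxx.
  by apply/eqP; rewrite eqEsubset BS; apply/subsetP => k; rewrite !inE => /orP[]/eqP->.
- suff -> : B = [set i] by rewrite eqxx.
  apply/setP => k; rewrite !inE; apply/idP/eqP => [Bk|-> //].
  by move: (subsetP BS k Bk); rewrite !inE => /orP[]/eqP // kj; rewrite -kj Bk in Bj.
- suff -> : B = [set j] by rewrite eqxx.
  apply/setP => k; rewrite !inE; apply/idP/eqP => [Bk|-> //].
  by move: (subsetP BS k Bk); rewrite !inE => /orP[]/eqP // ki; rewrite -ki Bk in Bi.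
suff -> : B = set0 by rewrite eqxx.
apply/setP => k; rewrite !inE; apply/negbTE/negP => Bk.
by move: (subsetP BS k Bk); rewrite !inE => /orP[]/eqP e; rewrite -e Bk in Bi Bj.
Qed.

Lemma cong4_eq (x y : Z8) : cong4 x y -> 2 * x = 2 * y.
Proof.
have [e|e] := eqVneq (2 * x) (2 * y); first by [].
by move: e; elim/Z8_ind: x; elim/Z8_ind: y => e; rewrite ?eqxx // in e *.
Qed.

(** The coefficients at {2}, {1,3} and {2,4} of the image under [f] of
    [p + b g^{1} + 2 b g^{2} + c g^{3} + 2 c g^{4}]. *)
Lemma preservesZ_laws n (f : op n) (p b c : 'I_n -> Z8) : preservesZ f ->
  [/\ 2 * (f (fun i => p i + 2 * b i) - f p) = 4 * (f (fun i => p i + b i) - f p),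
      4 * (f (fun i => p i + b i + c i) - f (fun i => p i + b i)
           - f (fun i => p i + c i) + f p) = 0 &
      f (fun i => p i + 2 * b i + 2 * c i) - f (fun i => p i + 2 * b i)
      - f (fun i => p i + 2 * c i) + f p = 0].
Proof.
move=> Hf; pose S k : {set 'I_4} := [set inord k].
have iE k l : (k < 4)%N -> (l < 4)%N -> (inord k == inord l :> 'I_4) = (k == l).
  by move=> k4 l4; rewrite -val_eqE /= !inordK.
have SE k l : (k < 4)%N -> (l < 4)%N -> (S k == S l) = (k == l).
  by move=> k4 l4; rewrite (inj_eq set1_inj) iE.
have S0 k : (S k == set0) = false.
  by apply/negbTE/set0Pn; exists (inord k); rewrite inE.
pose al i (B : {set 'I_4}) : Z8 :=
  if B == set0 then p i else if B == S 0%N then b i else if B == S 1%N then 2 * b i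
  else if B == S 2%N then c i else if B == S 3%N then 2 * c i else 0.
have al_big i (B : {set 'I_4}) : (2 <= #|B|)%N -> al i B = 0.
  move=> B2; have nS k : (B == S k) = false.
    by apply/eqP => e; rewrite e cards1 in B2.
  by rewrite /al !nS; case: eqP => // e; rewrite e cards0 in B2.
have al0 i : al i set0 = p i by rewrite /al eqxx.
have al1 i : al i (S 0%N) = b i by rewrite /al S0 eqxx.
have al2 i : al i (S 1%N) = 2 * b i by rewrite /al S0 !SE.
have al3 i : al i (S 2%N) = c i by rewrite /al S0 !SE.
have al4 i : al i (S 3%N) = 2 * c i by rewrite /al S0 !SE.
pose us i B := \sum_A al i A * gA A B.
have [|a [fE [[a1 _] [a2 [_ a4]]]]] := Hf us.
  move=> i; exists (al i); do ![split] => //.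
  - by rewrite al1 al2 /cong4.
  - by rewrite al3 al4 /cong4.
  - by move=> B B2; rewrite al_big.
  - by move=> B B2; rewrite al_big.
  move=> B B1 B3; rewrite al_big // (cardD1 (inord 1)) (cardD1 (inord 3)) !inE.
  by rewrite B1 B3 /= iE.
have n02 : inord 0 != inord 2 :> 'I_4 by rewrite iE.
have n13 : inord 1 != inord 3 :> 'I_4 by rewrite iE.
have f0 : f p = a set0.
  rewrite -subset_sum0 -fE; congr f.
  by apply: functional_extensionality => i; rewrite /us subset_sum0.
have f1 k : f (fun i => p i + al i (S k)) = a set0 + a (S k).
  rewrite -subset_sum1 -fE; congr f.
  by apply: functional_extensionality => i; rewrite /us subset_sum1 al0.
have f2 k l : (inord k != inord l :> 'I_4) ->
    f (fun i => p i + al i (S k) + al i (S l)) =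
    a set0 + a (S k) + a (S l) + a [set inord k; inord l].
  move=> kl; rewrite -subset_sum_pair // -fE; congr f; apply: functional_extensionality => i.
  rewrite /us subset_sum_pair // al0 [X in _ = _ + X]al_big ?addr0 //.
  by rewrite cards2 kl.
have e1 : (fun i => p i + al i (S 0%N)) = (fun i => p i + b i).
  by apply: functional_extensionality => i; rewrite al1.
have e2 : (fun i => p i + al i (S 1%N)) = (fun i => p i + 2 * b i).
  by apply: functional_extensionality => i; rewrite al2.
have e3 : (fun i => p i + al i (S 2%N)) = (fun i => p i + c i).
  by apply: functional_extensionality => i; rewrite al3.
have e4 : (fun i => p i + al i (S 3%N)) = (fun i => p i + 2 * c i).
  by apply: functional_extensionality => i; rewrite al4.
have e5 : (fun i => p i + al i (S 0%N) + al i (S 2%N)) = (fun i => p i + b i + c i).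
  by apply: functional_extensionality => i; rewrite al1 al3.
have e6 : (fun i => p i + al i (S 1%N) + al i (S 3%N)) = (fun i => p i + 2 * b i + 2 * c i).
  by apply: functional_extensionality => i; rewrite al2 al4.
(* By inclusion-exclusion the three laws are, in order, (Z1) for the first two elements, (Z2) at
   {1,3} and (Z4) at {2,4}. *)
rewrite -e1 -e2 -e3 -e4 -e5 -e6 !f1 !f2 // f0; split.
- transitivity (2 * a (S 1%N)); first by ring.
  by rewrite (cong4_eq a1); ring.
- transitivity (4 * a [set inord 0; inord 2]); first by ring.
  by rewrite mul4_odd (negbTE (a2 _ _)) ?mulr0 // cards2 n02.
rewrite (a4 [set inord 1; inord 3]) ?inE ?eqxx ?orbT //; ring.
Qed.

(** Stated so as to depend on [G] modulo 4 only, since it is [2 G] that occurs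
    in [redop]. *)
Definition even_affine n (G : op n) : Prop := forall p b c,
  4 * G (fun i => p i + 2 * b i) = 4 * G p /\
  2 * (G (fun i => p i + 2 * b i + 2 * c i) - G (fun i => p i + 2 * b i)
       - G (fun i => p i + 2 * c i) + G p) = 0.

Lemma half_of_mul4 (x y : Z8) : 4 * x = 4 * y -> exists k, x = y + 2 * k.
Proof.
move=> e; have z : 4 * (x - y) = 0 by rewrite mulrBr e subrr.
have [k ek] : exists k, x - y = 2 * k.
  have := parity_spec (x - y); case: ifP => // o.
  by rewrite mul4_odd o in z.
by exists k; rewrite -ek; ring.
Qed.

Lemma quarter_of_mul2 (x : Z8) : 2 * x = 0 -> exists k, x = 4 * k.
Proof. by elim/Z8_ind: x => // _; [exists 0 | exists 1]; apply/eqP. Qed.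

(** * Polynomials with vanishing second differences along even steps *)

Section EvenAffine.
Context (n : nat).
Implicit Types G H : op n.

Lemma even_affine_const k : even_affine (fun _ : 'I_n -> Z8 => k).
Proof. by move=> p b c; split=> //; ring. Qed.

Lemma even_affine_proj i : even_affine (fun x : 'I_n -> Z8 => x i).
Proof.
move=> p b c; split; last by ring.
by transitivity (4 * p i + 8 * b i); [ring | rewrite char8; ring].
Qed.

Lemma even_affine_add G H :
  even_affine G -> even_affine H -> even_affine (fun x => G x + H x).
Proof.
move=> hG hH p b c; have [g1 g2] := hG p b c; have [h1 h2] := hH p b c.
split; first by rewrite !mulrDr g1 h1.
by transitivity (0 + 0 : Z8); [rewrite -{1}g2 -h2; ring | ring].
Qed.

(** Beyond the second differences of the factors, the second difference of a product contains only
    products of first differences. Those are even, so twice such a product is a multiple of 8. *)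
Lemma even_affine_mul G H :
  even_affine G -> even_affine H -> even_affine (fun x => G x * H x).
Proof.
move=> hG hH p b c; have [g1 g2] := hG p b c; have [h1 h2] := hH p b c.
have [g3 _] := hG p c c; have [h3 _] := hH p c c.
split; first by rewrite !mulrA g1 -!mulrA mulrCA h1; ring.
have [k ek] := half_of_mul4 g1; have [k' ek'] := half_of_mul4 g3.
have [l el] := half_of_mul4 h1; have [l' el'] := half_of_mul4 h3.
move: g2 h2 ek ek' el el'.
set p12 := G _; set p1 := G _; set p2 := G _; set p0 := G _.
set q12 := H _; set q1 := H _; set q2 := H _; set q0 := H _ => g2 h2 ek ek' el el'.
transitivity (2 * (p12 - p1 - p2 + p0) * q12 + (p1 + p2 - p0) * (2 * (q12 - q1 - q2 + q0))
  + 2 * ((p1 - p0) * (q2 - q0) + (p2 - p0) * (q1 - q0))); first by ring.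
rewrite g2 h2 ek ek' el el'.
by transitivity (8 * (k * l' + k' * l)); [ring | rewrite char8 mul0r].
Qed.

Lemma even_affine_sum (I : finType) (P : pred I) (F : I -> op n) :
  (forall i, even_affine (F i)) -> even_affine (fun x => \sum_(i | P i) F i x).
Proof.
move=> hF; elim: (index_enum I) => [|i r IH].
  rewrite (_ : (fun x => _) = fun=> 0); first exact: even_affine_const.
  by apply: op_ext => x; rewrite big_nil.
rewrite (_ : (fun x => _) =
  fun x => (if P i then F i x else 0) + \sum_(i <- r | P i) F i x); last first.
  by apply: op_ext => x; rewrite big_cons; case: ifP => // _; rewrite add0r.
apply: even_affine_add => //; case: (P i) => //; exact: even_affine_const.
Qed.

Lemma even_affine_prod (I : finType) (F : I -> op n) :
  (forall i, even_affine (F i)) -> even_affine (fun x => \prod_i F i x).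
Proof.
move=> hF; elim: (index_enum I) => [|i r IH].
  rewrite (_ : (fun x => _) = fun=> 1); first exact: even_affine_const.
  by apply: op_ext => x; rewrite big_nil.
rewrite (_ : (fun x => _) = fun x => F i x * \prod_(i <- r) F i x).
  exact: even_affine_mul.
by apply: op_ext => x; rewrite big_cons.
Qed.

(** Reduced operations thus satisfy the third law of [preservesZ_laws], and so does the difference
    of two operations satisfying it. *)
Lemma redop_biaffine a (b c p u v : 'I_n -> Z8) :
  redop a b c (fun i => p i + 2 * u i + 2 * v i)
  - redop a b c (fun i => p i + 2 * u i) - redop a b c (fun i => p i + 2 * v i)
  + redop a b c p = 0.
Proof.
have /(_ p u v) [_] : even_affine
    (fun x => prodx x * (a + \sum_i (x i - 1) * (c i + b i * x i))).
  have cst := even_affine_const; have pr := even_affine_proj.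
  apply: even_affine_mul; first exact: even_affine_prod.
  apply: even_affine_add => //; apply: even_affine_sum => i.
  apply: even_affine_mul; first exact: (even_affine_add (pr i) (cst (-1))).
  apply: even_affine_add => //; exact: even_affine_mul.
by move=> e; rewrite -[RHS]e /redop; ring.
Qed.

End EvenAffine.

(** * Normal form of operations that vanish when an argument is 0 *)

Definition vanishing n (f : op n) : Prop :=
  forall x i, x i = 0 -> f x = 0.

Notation ones := (fun=> 1 : Z8).

Lemma vanishing_redop n a b c : vanishing (redop (n := n) a b c).
Proof. by move=> x i xi; rewrite /redop (prodxD1 i) xi !mul0r mulr0. Qed.

Lemma redop_upd_ones n a b c (i : 'I_n) y :
  redop a b c (upd i y ones) = 2 * (y * (a + (y - 1) * (c i + b i * y))).
Proof.
rewrite redop_upd big1 // big1 => [|j _]; last by rewrite subrr mul0r.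
by rewrite mulr1 addr0.
Qed.

(** Write [x] as a 0-1 vector plus twice a vector. By the first hypothesis [h] is affine in the
    latter, so it suffices to treat the 0-1 vector itself and its shifts by 2 in one coordinate.
    Such a point has a zero coordinate or is one of the listed test points. *)
Lemma vanishing_biaffine_eq0 n (h : op n.+1) :
  (forall p u v, h (fun i => p i + 2 * u i + 2 * v i) - h (fun i => p i + 2 * u i)
     - h (fun i => p i + 2 * v i) + h p = 0) ->
  vanishing h -> h ones = 0 ->
  (forall j, h (upd j 2 ones) = 0) -> (forall j, h (upd j 3 ones) = 0) ->
  forall x, h x = 0.
Proof.
move=> hC h0 h1 h2 h3 x.
have step p u v : h p = 0 -> h (fun i => p i + 2 * u i) = 0 ->
    h (fun i => p i + 2 * v i) = 0 -> h (fun i => p i + 2 * u i + 2 * v i) = 0.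
  by move=> e1 e2 e3; rewrite -(hC p u v) e1 e2 e3; ring.
pose al i : Z8 := (odd (x i))%:R.
have [be xE] : exists be : 'I_n.+1 -> Z8, forall i, x i = al i + 2 * be i.
  apply: (fin_all_exists (P := fun i k => x i = al i + 2 * k)) => i.
  by apply: half_of_mul4; rewrite mul4_odd.
have hal : h al = 0.
  have [/forallP o|] := boolP [forall i, odd (x i)].
    by rewrite -[RHS]h1; congr h; apply: functional_extensionality => i; rewrite /al o.
  by rewrite negb_forall => /existsP[i /negbTE oi]; apply: (h0 _ i); rewrite /al oi.
have hal1 j : h (fun i => al i + 2 * ind j i) = 0.
  have [/existsP[i /andP[ij /negbTE oi]]|] := boolP [exists i, (i != j) && ~~ odd (x i)].
    by apply: (h0 _ i); rewrite /al /ind oi (negbTE ij); apply/eqP.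
  rewrite negb_exists => /forallP o.
  have e : (fun i => al i + 2 * ind j i) = upd j (al j + 2) ones.
    apply: functional_extensionality => i; rewrite /upd /ind.
    have := o i; have [-> _|ij] := eqVneq i j; first by rewrite mulr1.
    by rewrite /= negbK /al => ->; apply/eqP.
  rewrite e /al; case: (odd (x j)).
    by rewrite (_ : true%:R + 2 = 3) ?h3 //; apply/eqP.
  by rewrite (_ : false%:R + 2 = 2) ?h2 //; apply/eqP.
have halm j m : h (fun i => al i + 2 * (m%:R * ind j i)) = 0.
  elim: m => [|m IH].
    by rewrite -[RHS]hal; congr h; apply: functional_extensionality => i; ring.
  rewrite -(step al (fun i => m%:R * ind j i) (ind j)) //; congr h.
  by apply: functional_extensionality => i; rewrite -(addn1 m) natrD; ring.
(* The even part is built up coordinate by coordinate; once [k] exceeds every index the truncation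
   changes nothing. *)
have pre k : h (fun i => al i + 2 * (be i * (i < k)%:R)) = 0.
  elim: k => [|k IH].
    by rewrite -[RHS]hal; congr h; apply: functional_extensionality => i; rewrite ltn0 /=; ring.
  have [kn|kn] := ltnP k n.+1; last first.
    rewrite -[RHS]IH; congr h; apply: functional_extensionality => i.
    by rewrite !(leq_trans (ltn_ord i)) // ltnW.
  pose j := Ordinal kn; have := halm j (be j); rewrite natr_Zp => hj.
  rewrite -(step al (fun i => be i * (i < k)%:R) (fun i => be j * ind j i)) //; congr h.
  apply: functional_extensionality => i; rewrite ltnS leq_eqVlt /ind -val_eqE /=.
  have [ik|_] := eqVneq (i : nat) k; last by rewrite /=; ring.
  by rewrite (_ : i = j) ?ltnn /=; [ring | apply: val_inj].
rewrite -[RHS](pre n.+1); congr h; apply: functional_extensionality => i.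
by rewrite ltn_ord xE mulr1.
Qed.

(** The first law, based at [upd j 0 ones] and at [ones], makes [f (upd j 2 ones)] and
    [f (upd j 3 ones) - f ones] multiples of 4. Hence some reduced operation agrees with [f] at all
    test points of [vanishing_biaffine_eq0]. *)
Lemma redop_normal_form n (f : op n.+1) :
  preservesZ f -> vanishing f -> 4 * f ones = 0 ->
  exists a b c, f = redop a b c.
Proof.
move=> Hf f0 f1; have laws p b c := preservesZ_laws p b c Hf.
have [a ea] : exists a, f ones = 2 * a.
  by have [|a ->] := @half_of_mul4 (f ones) 0; [rewrite f1 mulr0|exists a; rewrite add0r].
have [c ec] : exists c : 'I_n.+1 -> Z8, forall j, f (upd j 2 ones) = 4 * c j.
  apply: (fin_all_exists (P := fun j k => f (upd j 2 ones) = 4 * k)) => j.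
  apply: quarter_of_mul2; have [e _ _] := laws (upd j 0 ones) (ind j) ones.
  move: e; rewrite (f0 (upd j 0 ones) j) ?upd_eq // !subr0.
  rewrite (_ : (fun i => _ + 2 * _) = upd j 2 ones); last first.
    by apply: functional_extensionality => i; rewrite /upd /ind; case: eqP => _ /=; ring.
  rewrite (_ : (fun i => _ + _) = ones) ?f1 //.
  by apply: functional_extensionality => i; rewrite /upd /ind; case: eqP => _ /=; ring.
have [b eb] : exists b : 'I_n.+1 -> Z8, forall j, f (upd j 3 ones) = f ones + 4 * b j.
  apply: (fin_all_exists (P := fun j k => f (upd j 3 ones) = f ones + 4 * k)) => j.
  suff [k ek] : exists k, f (upd j 3 ones) - f ones = 4 * k by exists k; rewrite -ek; ring.
  apply: quarter_of_mul2; have [e _ _] := laws ones (ind j) ones.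
  move: e; rewrite (_ : (fun i => _ + 2 * _) = upd j 3 ones); last first.
    by apply: functional_extensionality => i; rewrite /upd /ind; case: eqP => _ /=; ring.
  rewrite (_ : (fun i => _ + _) = upd j 2 ones); last first.
    by apply: functional_extensionality => i; rewrite /upd /ind; case: eqP => _ /=; ring.
  move=> ->; rewrite ec mulrBr f1.
  by transitivity (8 * (2 * c j)); [ring | rewrite char8 mul0r].
(* The reduced operation takes the value [4 * (a + cc j)] at [upd j 2 ones] and
   [2 * a + 4 * (a + cc j + bb j)] at [upd j 3 ones]; these are equated with the values of [f]. *)
pose cc i := c i - a; pose bb i := b i - c i.
exists a, bb, cc; apply: op_ext => x; apply/eqP; rewrite -subr_eq0; apply/eqP.
have z8 (k : Z8) : 8 * k = 0 by rewrite char8 mul0r.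
apply: (vanishing_biaffine_eq0 (h := fun x => f x - redop a bb cc x)) => [p u v|y i yi|||].
- have [_ _ e1] := laws p u v; have e2 := redop_biaffine a bb cc p u v.
  by transitivity (0 - 0 : Z8); [rewrite -{1}e1 -e2; ring | rewrite subr0].
- by rewrite (f0 _ _ yi) (vanishing_redop _ _ _ yi) subr0.
- by rewrite -(upd_same ord0 ones) redop_upd_ones upd_same ea; ring.
- by move=> j; rewrite redop_upd_ones ec /cc /bb -(z8 (- b j + c j)); ring.
move=> j; rewrite redop_upd_ones eb ea /cc /bb -(z8 (- 4 * b j + 3 * c j + a)); ring.
Qed.

(** * Joins and the choice of an extended index *)

Lemma clone_gen_clone S : is_clone (clone_gen S).
Proof.
split=> [n i D [Dp _] _ | m n f gs Cf_ Cg D DC DS]; first exact: Dp.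
by case: (DC) => _; apply=> [|i]; [apply: Cf_ | apply: Cg].
Qed.

Lemma clone_gen_sub (S : opset) n (f : op n) : S n f -> clone_gen S n f.
Proof. by move=> Sf D _; apply. Qed.

Lemma join2_sub (A B C : opset) : is_clone C ->
  (forall n f, A n f -> C n f) -> (forall n f, B n f -> C n f) ->
  forall n f, join2 A B n f -> C n f.
Proof. by move=> HC AC BC n f; apply=> // m g [/AC|/BC]. Qed.

Lemma join2_l (A B : opset) n f : A n f -> join2 A B n f.
Proof. by move=> Af; apply: clone_gen_sub; left. Qed.

Lemma join2_r (A B : opset) n f : B n f -> join2 A B n f.
Proof. by move=> Bf; apply: clone_gen_sub; right. Qed.

Lemma joinand_mem lo (fam : forall n, op n) k n : (lo <= n)%N -> ext_match k n ->
  joinand lo fam k n (fam n).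
Proof.
move=> lon kn; apply: clone_gen_sub; exists (exist _ n (conj lon kn)).
by apply: clone_gen_sub; right; exists erefl.
Qed.

Lemma joinand_sub (C : opset) lo (fam : forall n, op n) k : affine_clone C ->
  (forall n, (lo <= n)%N -> ext_match k n -> C n (fam n)) ->
  forall n f, joinand lo fam k n f -> C n f.
Proof.
move=> [HC PC] famC n f; apply=> // m g [[l [lol kl]] /=]; apply=> // m' g' [gadd|[e]].
  by apply: PC; apply: clone_gen_sub.
by case: m' / e g' => g' <-; apply: famC.
Qed.

(** Nullary operations need separate care: [is_clone] allows them, but no
    operation of positive arity generates one. *)
Lemma Pring_nullary (f : op 0) : Pring 0 f -> False.
Proof.
move=> Pf; suff : (0 < 0)%N by [].
apply: (Pf (fun n _ => 0 < n)%N) => [|m g [[[e _]|[c [e _]]]|[e _]]]; try by case: m / e g.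
split=> [n i|m n _ _ m0 n0]; first exact: leq_ltn_trans (leq0n i) (ltn_ord i).
exact: (n0 (Ordinal m0)).
Qed.

(** A downward closed set of indices is determined by its maximum, by being unbounded ([Inf]), or by
    being empty. The empty case is [Fin 0], which matches no admissible index because [lo] is
    positive. *)
Lemma max_index (P : nat -> Prop) lo : (0 < lo)%N ->
  (forall n, (lo <= n)%N -> P n.+1 -> P n) ->
  exists k : ext_nat, (forall n, (lo <= n)%N -> ext_match k n -> P n) /\
    (forall n, (lo <= n)%N -> P n -> exists N, (n <= N)%N /\ ext_match k N).
Proof.
move=> lo0 down.
have down_le m n : (lo <= m)%N -> (m <= n)%N -> P n -> P m.
  move=> lom; elim: n => [|n IH]; first by rewrite leqn0 => /eqP ->.
  rewrite leq_eqVlt => /orP[/eqP <- //|mn] Pn.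
  by apply: IH => //; apply: down => //; exact: leq_trans lom mn.
have [bnd|unb] := classic (exists M, forall n, (lo <= n)%N -> P n -> (n < M)%N); last first.
  exists Inf; split=> [n lon _|n _ _]; last by exists n.
  apply: NNPP => nP; apply: unb; exists n => m lom Pm.
  by rewrite ltnNge; apply/negP => nm; apply: nP; apply: down_le Pm.
(* The strict bound is lowered until it lies just above an element, which is then the maximum. *)
case: bnd => M; elim: M => [|M IH] bnd.
  exists (Fin 0); split=> [n lon n0|n lon /(bnd n lon)] //.
  by rewrite n0 leqNgt lo0 in lon.
have [[loM PM]|nPM] := classic ((lo <= M)%N /\ P M).
  exists (Fin M); split=> [n _ ->|n lon Pn] //; exists M; split=> //.
  exact: bnd lon Pn.
apply: IH => n lon Pn; rewrite ltn_neqAle -ltnS bnd // andbT.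
by apply/eqP => e; apply: nPM; rewrite -e.
Qed.

Lemma fam_down_le D F m n : affine_clone D -> (fam_lo F <= m)%N -> (m <= n)%N ->
  D n (fam_op F n) -> D m (fam_op F m).
Proof.
move=> HD lom; elim: n => [|n IH]; first by rewrite leqn0 => /eqP ->.
rewrite leq_eqVlt => /orP[/eqP <- //|mn] Dn.
by apply: IH => //; apply: fam_down => //; exact: leq_trans lom mn.
Qed.

(** * Reduction of arbitrary operations in [M1] to vanishing ones *)

Section Reduction.
Context (C J : opset) (HC : affine_clone C) (HJ : affine_clone J).
Arguments C : clear implicits.
Arguments J : clear implicits.
Hypothesis CM1 : forall n f, C n f -> M1 n f.
Hypothesis CJ : forall F n, (fam_lo F <= n)%N -> C n (fam_op F n) -> J n (fam_op F n).

Lemma clone_upd (D : opset) n (f : op n.+1) i k : affine_clone D -> D n.+1 f ->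
  D n.+1 (fun x => f (upd i k x)).
Proof.
move=> HD Df; apply: (clone_comp HD (gs := fun j x => upd i k x j)) => // j.
by rewrite /upd; case: (j == i); [apply: clone_const | apply: clone_proj].
Qed.

(** For each [i] in [r] the operation with [x i := 0] is subtracted. The subtracted terms lie in [J]
    by hypothesis, and each subtraction preserves the vanishing achieved before. *)
Lemma exists_vanishing n (f : op n.+1) (r : seq 'I_n.+1) :
  (forall g i, C n.+1 g -> J n.+1 (fun x => g (upd i 0 x))) ->
  C n.+1 f -> exists g : op n.+1, [/\ C n.+1 g, J n.+1 g -> J n.+1 f &
    forall i x, i \in r -> x i = 0 -> g x = 0].
Proof.
move=> Jupd Cf_; elim: r => [|i r [g [Cg Jg g0]]]; first by exists f.
exists (fun x => g x - g (upd i 0 x)); split.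
- by apply: (clone_sub HC) => //; exact: (clone_upd i 0 HC Cg).
- move=> Jd; apply: Jg; apply: (clone_ext (clone_add HJ Jd (Jupd g i Cg))) => x.
  by rewrite subrK.
move=> j x; rewrite inE => /orP[/eqP -> x0|jr x0].
  by rewrite (_ : upd i 0 x = x) ?subrr // -x0 upd_same.
by rewrite !(g0 j) ?subr0 // /upd; case: ifP.
Qed.

(** The normal form requires [f ones] to be even. In arity at least 2 the second law gives this:
    starting from two zero coordinates and stepping each to 1, only the value at [ones] survives. In
    arity 1 a multiple of the variable is subtracted first. *)
Lemma vanishing_mem n (f : op n.+1) : vanishing f -> C n.+1 f -> J n.+1 f.
Proof.
have red m (g : op m.+1) : vanishing g -> 4 * g ones = 0 -> C m.+1 g -> J m.+1 g.
  move=> g0 g1 Cg; have [_ gZ] := CM1 Cg.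
  have [a [b [c eg]]] := redop_normal_form gZ g0 g1.
  by rewrite eg in Cg *; exact: (redop_mem HC HJ CJ Cg).
case: n f => [|n] f f0 Cf_; last first.
  apply: red => //; have [_ fZ] := CM1 Cf_.
  pose p : 'I_n.+2 -> Z8 := upd ord0 0 (upd ord_one 0 ones).
  have [_ e _] := preservesZ_laws p (ind ord0) (ind ord_one) fZ.
  rewrite (f0 (fun i => p i + ind ord0 i) ord_one) in e; last by apply/eqP.
  rewrite (f0 (fun i => p i + ind ord_one i) ord0) in e; last by apply/eqP.
  rewrite (f0 p ord0) // subr0 subr0 addr0 in e; rewrite -[RHS]e; congr (4 * f _).
  apply: functional_extensionality => i; rewrite /p /upd /ind.
  have [->|i0] := eqVneq i ord0; first by apply/eqP.
  by have [_|_] := eqVneq i ord_one; apply/eqP.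
pose l (x : 'I_1 -> Z8) := f ones * x ord0.
have Dl (D : opset) : affine_clone D -> D 1 l.
  by move=> HD; apply: (clone_scale HD); apply: clone_proj.
have Jd : J 1 (fun x => f x - l x).
  apply: red => [x i xi||]; last by apply: (clone_sub HC) => //; apply: Dl.
    by rewrite (f0 _ _ xi) /l (_ : ord0 = i) ?xi ?mulr0 ?subr0 // (ord1 i).
  by rewrite /l mulr1 subrr mulr0.
by apply: (clone_ext (clone_add HJ Jd (Dl J HJ))) => x; rewrite subrK.
Qed.

Lemma clone_mem n (f : op n) : C n f -> J n f.
Proof.
elim: n f => [|n IH] f Cf_; first by have [/Pring_nullary] := CM1 Cf_.
have [|g [Cg Jg g0]] := exists_vanishing (index_enum 'I_n.+1) _ Cf_.
  (* In arity 1, setting the variable to 0 leaves a constant; it is taken as a unary operation,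
     since the induction hypothesis for arity 0 could not supply it. *)
  move=> h i Ch; case: n i h Ch {f Cf_} IH => [|n] i h Ch IH.
    apply: (clone_ext (clone_const HJ 0 (h (fun=> 0)))) => x; congr h.
    by apply: functional_extensionality => j; rewrite /upd !(ord1 i) !(ord1 j).
  pose gs (j : 'I_n.+2) : op n.+1 := if unlift i j is Some k then fun x => x k else fun=> 0.
  have Cgs j : C n.+1 (gs j).
    by rewrite /gs; case: unlift => *; [apply: clone_proj | apply: clone_const].
  have /IH Jh := clone_comp HC Ch Cgs.
  apply: (clone_ext (clone_reindex HJ (lift i) Jh)) => x; congr h.
  apply: functional_extensionality => j; rewrite /gs /upd.
  by case: unliftP => [k ->|->]; rewrite ?eqxx // eq_sym (negbTE (neq_lift i k)).
by apply: Jg; apply: vanishing_mem => // x i; apply: g0; rewrite mem_index_enum.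
Qed.

End Reduction.

(** * Choice of the eight parameters and the two inclusions *)

Theorem theorem4p3 (C : opset) :
  is_clone C ->
  (forall n f, PZ8 n f -> C n f) ->
  (forall n f, C n f -> M1 n f) ->
  exists n1 n2 n3 n4 n5 n6 n7 n8 : ext_nat,
    forall n (f : op n), C n f <-> join_expr n1 n2 n3 n4 n5 n6 n7 n8 n f.
Proof.
move=> cC PC CM1; have HC : affine_clone C by [].
have lo0 F : (0 < fam_lo F)%N by case: F.
have choose F := @max_index (fun n => C n (fam_op F n)) (fam_lo F) (lo0 F)
  (fun n lon => fam_down HC lon).
have [k kP] : exists k : family -> ext_nat, forall F,
    (forall n, (fam_lo F <= n)%N -> ext_match (k F) n -> C n (fam_op F n)) /\
    (forall n, (fam_lo F <= n)%N -> C n (fam_op F n) ->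
       exists N, (n <= N)%N /\ ext_match (k F) N).
  have [k1 h1] := choose FT; have [k2 h2] := choose FU.
  have [k3 h3] := choose FV; have [k4 h4] := choose FS.
  have [k5 h5] := choose FP; have [k6 h6] := choose FQ.
  have [k7 h7] := choose FR; have [k8 h8] := choose FR4.
  exists (fun F => match F with FT => k1 | FU => k2 | FV => k3 | FS => k4
    | FP => k5 | FQ => k6 | FR => k7 | FR4 => k8 end).
  by case.
exists (k FT), (k FU), (k FV), (k FS), (k FP), (k FQ), (k FR), (k FR4).
set J := join_expr _ _ _ _ _ _ _ _.
have HJ : affine_clone J.
  by split=> [|n f Pf]; [apply: clone_gen_clone | apply: join2_l].
have kJ F n : (fam_lo F <= n)%N -> ext_match (k F) n -> J n (fam_op F n).
  move=> lon kn; have := @joinand_mem _ (fam_op F) _ _ lon kn.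
  by case: F lon kn => _ _ H; do ?[exact: H | by apply: join2_l | apply: join2_r].
have JC n f : J n f -> C n f.
  have jC F := @joinand_sub C _ (fam_op F) _ HC (proj1 (kP F)).
  apply: (join2_sub cC PC); apply: (join2_sub cC (jC FT)).
  apply: (join2_sub cC (jC FU)); apply: (join2_sub cC (jC FV)).
  apply: (join2_sub cC (jC FS)); apply: (join2_sub cC (jC FP)).
  by apply: (join2_sub cC (jC FQ)); apply: (join2_sub cC (jC FR)); apply: (jC FR4).
move=> n f; split; last exact: JC.
apply: (clone_mem HC HJ CM1) => F m lom Cm.
(* The join contains a family member of some index [N] at least [m], and the descent to [m] takes
   place inside [J]. *)
have [N [mN kN]] := proj2 (kP F) m lom Cm.
by apply: (fam_down_le HJ lom mN); apply: kJ => //; apply: leq_trans mN.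
Qed.
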